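(* Let $\Psi$ be a maximal root subsystem of a reduced affine reflection system $\Phi$ (irreducible components of type $A_1$ being allowed). Then either $\Psi$ is closed in $\Phi$ or $\Psi^\vee$ is closed in $\Phi^\vee$.
   Context: Let $\mathring\Phi$ be a finite reduced crystallographic root system (not necessarily irreducible) in a Euclidean space $V$ (with $0\notin\mathring\Phi$), $(\beta,\alpha^\vee)=2(\beta,\alpha)/(\alpha,\alpha)$, $s_\alpha(\beta)=\beta-(\beta,\alpha^\vee)\alpha$, and let $Y$ be a finite-dimensional real vector space. An extension datum of type $(\mathring\Phi,Y)$ is a family of subsets $\Lambda_\alpha\subseteq Y$, $\alpha\in\mathring\Phi\cup\{0\}$, such that: $\Lambda_\beta-(\beta,\alpha^\vee)\Lambda_\alpha\subseteq\Lambda_{s_\alpha(\beta)}$ for all $\alpha,\beta\in\mathring\Phi$; $0\in\Lambda_\alpha$ for all $\alpha$; and $Y$ is the real span of $\bigcup_\alpha\Lambda_\alpha$ (operations on subsets are elementwise). The associated reduced affine reflection system is identified (ignoring imaginary roots) with its set of real roots $\Phi=\bigcup_{\alpha\in\mathring\Phi}\alpha\oplus\Lambda_\alpha\subseteq X=V\oplus Y$, where $\alpha\oplus A=\{\alpha\oplus a:a\in A\}$, with the form $(v_1\oplus y_1,v_2\oplus y_2)=(v_1,v_2)$ and reflections $s_\gamma(x)=x-\frac{2(x,\gamma)}{(\gamma,\gamma)}\gamma$ for $\gamma\in\Phi$. Every reduced affine reflection system (with finite underlying root system) is of this form up to isomorphism. Standing assumption: for each irreducible component of $\mathring\Phi$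 of type $B_2$, the set $\Lambda_\ell$ (the common value of $\Lambda_\alpha$ over the long roots $\alpha$ of that component) is a subgroup of $Y$. A root subsystem of $\Phi$ is a non-empty subset $\Psi\subseteq\Phi$ with $s_\alpha(\beta)\in\Psi$ for all $\alpha,\beta\in\Psi$; it is maximal if it is proper and not strictly contained in another proper root subsystem. It is closed in $\Phi$ if $\alpha,\beta\in\Psi$ and $\alpha+\beta\in\Phi$ imply $\alpha+\beta\in\Psi$. Duals: for $\gamma\in\Phi$, $\gamma^\vee=\frac{2\gamma}{(\gamma,\gamma)}\in X$; $\Phi^\vee=\{\gamma^\vee:\gamma\in\Phi\}$ (in the same space $X$ with the same form) and $\Psi^\vee=\{\gamma^\vee:\gamma\in\Psi\}$. *)

(* Defs.v *)
From mathcomp Require Import all_boot all_order all_algebra.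
From mathcomp Require Import all_classical reals.

Set Implicit Arguments.
Unset Strict Implicit.
Unset Printing Implicit Defensive.

Import Order.TTheory GRing.Theory Num.Theory.

Local Open Scope classical_set_scope.
Local Open Scope ring_scope.

Definition span_set (R : realType) (U : vectType R) (A : set U) : set U :=
  [set v | exists2 s : seq U, (forall x, x \in s -> A x) & v \in <<s>>%VS].

Section Reflections.
Variables (R : realType) (U : lmodType R) (form : U -> U -> R).

(* The number (b, a^vee). *)
Definition pairing (b a : U) : R := 2 * form b a / form a a.

Definition reflection (a b : U) : U := b - pairing b a *: a.

Definition coroot (a : U) : U := (2 / form a a) *: a.

Definition is_root_subsystem (Phi Psi : set U) : Prop :=
  [/\ Psi !=set0, Psi `<=` Phi &
      forall a b, Psi a -> Psi b -> Psi (reflection a b)].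

Definition is_maximal_root_subsystem (Phi Psi : set U) : Prop :=
  [/\ is_root_subsystem Phi Psi, Psi `<` Phi &
      ~ exists Psi', [/\ is_root_subsystem Phi Psi', Psi' `<` Phi
                       & Psi `<` Psi']].

Definition closed_in (Phi Psi : set U) : Prop :=
  forall a b, Psi a -> Psi b -> Phi (a + b) -> Psi (a + b).

End Reflections.

(* Finite, reduced, crystallographic root systems; the Euclidean space is V
   with the positive definite symmetric bilinear form [dot]. *)
Record is_root_system (R : realType) (V : vectType R) (dot : {dot V for idfun})
    (Phi0 : set V) : Prop := IsRootSystem {
  root_finite : finite_set Phi0;
  root_span : span_set Phi0 = setT;
  root_neq0 : forall a, Phi0 a -> a <> 0;
  root_refl : forall a b, Phi0 a -> Phi0 b -> Phi0 (reflection dot a b);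
  root_crystallographic : forall a b, Phi0 a -> Phi0 b ->
    exists n : int, pairing dot b a = n%:~R;
  root_reduced : forall a (c : R), Phi0 a -> Phi0 (c *: a) -> c = 1 \/ c = -1
}.

Section Components.
Variables (R : realType) (V : vectType R) (dot : {dot V for idfun}).

Definition orthogonal_sets (A B : set V) : Prop :=
  forall a b, A a -> B b -> dot a b = 0.

Definition is_irreducible (C : set V) : Prop :=
  C !=set0 /\ forall A B, A `|` B = C -> orthogonal_sets A B ->
    A = set0 \/ B = set0.

Definition is_component (Phi0 C : set V) : Prop :=
  [/\ C `<=` Phi0, is_irreducible C & orthogonal_sets C (Phi0 `\` C)].

(* C is a copy of the standard realization {+-e1, +-e2, +-e1+-e2} of B_2, up to
   rescaling the form: isomorphisms between irreducible root systems are
   similarities. *)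
Definition is_type_B2 (C : set V) : Prop :=
  exists e1 e2 : V,
    [/\ e1 != 0, dot e1 e1 = dot e2 e2, dot e1 e2 = 0 &
        C = [set` [:: e1; - e1; e2; - e2;
                      e1 + e2; e1 - e2; - e1 + e2; - e1 - e2]]].

Definition is_long (C : set V) (a : V) : Prop :=
  C a /\ forall b, C b -> dot b b <= dot a a.

End Components.

(* Only the values of Lam on Phi0 `|` [set 0] are meaningful. *)
Record is_extension_datum (R : realType) (V Y : vectType R)
    (dot : {dot V for idfun}) (Phi0 : set V) (Lam : V -> set Y) : Prop :=
    IsExtensionDatum {
  ext_refl : forall a b, Phi0 a -> Phi0 b -> forall x y, Lam b x -> Lam a y ->
    Lam (reflection dot a b) (x - pairing dot b a *: y);
  ext_zero : forall a, (Phi0 `|` [set 0]) a -> Lam a 0;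
  ext_span : span_set (\bigcup_(a in Phi0 `|` [set 0]) Lam a) = setT
}.

Definition is_subgroup (Y : zmodType) (A : set Y) : Prop :=
  A 0 /\ forall x y, A x -> A y -> A (x - y).

Definition B2_condition (R : realType) (V Y : vectType R)
    (dot : {dot V for idfun}) (Phi0 : set V) (Lam : V -> set Y) : Prop :=
  forall C, is_component dot Phi0 C -> is_type_B2 dot C ->
  forall a, is_long dot C a -> is_subgroup (Lam a).

Section AffineReflectionSystem.
Variables (R : realType) (V Y : vectType R) (dot : {dot V for idfun}).

(* The direct sum V (+) Y is the product V * Y. *)
Definition ext_form (x y : V * Y) : R := dot x.1 y.1.

Definition real_roots (Phi0 : set V) (Lam : V -> set Y) : set (V * Y) :=
  \bigcup_(a in Phi0) [set (a, y) | y in Lam a].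

Definition dual (Phi : set (V * Y)) : set (V * Y) := coroot ext_form @` Phi.

End AffineReflectionSystem.

(* Main.v *)
Require Import Defs.
From mathcomp Require Import all_boot all_order all_algebra.
From mathcomp Require Import all_classical reals.
From mathcomp Require Import ring lra zify.

Set Implicit Arguments.
Unset Strict Implicit.
Unset Printing Implicit Defensive.

Import Order.TTheory GRing.Theory Num.Theory.
Local Open Scope classical_set_scope.
Local Open Scope ring_scope.

(** Why the theorem holds.

    Suppose that a and b lie in the maximal subsystem Psi, that a + b is a real
    root, and that a + b is not in Psi.  If one of the two Cartan integers of a
    and b were -1, then a + b would be the reflection of one in the other, hence
    in Psi.  The remaining configurations are very few ([root_sum]): a and b
    have the same squared length n, they are orthogonal or at an angle of 60
    degrees, and a + b has squared length 2n (as in B2) or 3n (as in G2).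

    The heart of the proof is that Psi then contains every real root of squared
    length n ([roots_of_summand_length]).  Maximality says that a reflection
    stable set between Psi and Phi which contains one root outside Psi is all of
    Phi, and it is applied to several auxiliary sets.  The main one involves the
    set S of real roots of squared length n whose reflections map the roots of
    Psi of other lengths into Psi.  The reflections of Psi preserve S, and so
    does the reflection in a + b.  For d in S, up to replacing d by - d, that
    reflection fixes d or subtracts a + b from d, and the latter amounts to
    reflecting d in a and b one after the other, except when a and b are
    orthogonal and d lies over the same finite root as one of them, say a.  In
    that last case d - (a + b) lies over the same finite root as - b.  Either Psi is the full preimage of a subsystem of the finite
    root system, and then d - (a + b) is in Psi; or Psi has a root r over a - b,
    and the reflection in d - (a + b) is a product of three reflections in roots
    over b, namely b and the reflections of d and a in r
    ([stabilizer_orthogonal]).  Hence the reflections of Phi preserve S, so S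
    consists of all roots of squared length n, and adding them to Psi gives a
    reflection stable set which still misses a + b.  By maximality that set is
    Psi.

    Suppose now that the dual of Psi is not closed either, because of l and m in
    Psi whose coroots add up to the coroot of a root d outside Psi.  The rank two
    analysis applied to coroots ([coroot_sum]) makes l two or three times as
    long, in squared length, as d.  A further use of maximality shows that the
    missing roots a + b and d belong to the same part of Phi, in the sense that d
    is not orthogonal to some finite root of squared length n, nor to some finite
    root of the length of a + b ([missing_nonorthogonal]).  Non-orthogonal roots
    have length ratios 1, 2, 3 or their inverses, and these constraints leave
    only one possibility: d has squared length n.  But then d is in Psi. *)

(** * Reflections and coroots of a symmetric bilinear form *)

(** The form may be degenerate, as it is on V * Y; reflections in isotropic
    vectors are then trivial, since x / 0 = 0. *)
Section SymmetricForms.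
Variables (R : realType) (U : lmodType R) (form : U -> U -> R).
Hypotheses (formC : forall x y, form x y = form y x)
           (formDl : forall x y z, form (x + y) z = form x z + form y z)
           (formZl : forall k x y, form (k *: x) y = k * form x y).

Lemma sformDr x y z : form x (y + z) = form x y + form x z.
Proof. by rewrite formC formDl !(formC _ x). Qed.

Lemma sformZr k x y : form x (k *: y) = k * form x y.
Proof. by rewrite formC formZl formC. Qed.

Lemma sformNl x y : form (- x) y = - form x y.
Proof. by rewrite -scaleN1r formZl mulN1r. Qed.

Lemma sformNr x y : form x (- y) = - form x y.
Proof. by rewrite formC sformNl formC. Qed.

Lemma pairingDl x y a :
  pairing form (x + y) a = pairing form x a + pairing form y a.
Proof. by rewrite /pairing formDl mulrDr mulrDl. Qed.

Lemma pairingZl k x a : pairing form (k *: x) a = k * pairing form x a.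
Proof. by rewrite /pairing formZl mulrCA !mulrA. Qed.

Lemma pairingNl x a : pairing form (- x) a = - pairing form x a.
Proof. by rewrite -scaleN1r pairingZl mulN1r. Qed.

Lemma pairingNr x a : pairing form x (- a) = - pairing form x a.
Proof. by rewrite /pairing sformNl !sformNr opprK mulrN mulNr. Qed.

Lemma pairing_self a : form a a != 0 -> pairing form a a = 2.
Proof. by move=> a0; rewrite /pairing mulfK. Qed.

Lemma reflection_selfN a : form a a != 0 -> reflection form a a = - a.
Proof.
by move=> a0; rewrite /reflection pairing_self // scaler_nat mulr2n opprD addNKr.
Qed.

Lemma reflectionN a x : reflection form (- a) x = reflection form a x.
Proof. by rewrite /reflection pairingNr scaleNr scalerN opprK. Qed.

Lemma reflection_of_opp a x : reflection form a (- x) = - reflection form a x.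
Proof. by rewrite /reflection pairingNl scaleNr opprK opprB addrC. Qed.

Lemma reflectionB a x y :
  reflection form a (x - y) = reflection form a x - reflection form a y.
Proof.
rewrite /reflection pairingDl pairingNl scalerDl scaleNr !opprD !opprK.
by rewrite addrACA.
Qed.

Lemma reflectionZ a k x :
  reflection form a (k *: x) = k *: reflection form a x.
Proof. by rewrite /reflection pairingZl scalerBr scalerA. Qed.

Lemma reflection_isometry a x y :
  form (reflection form a x) (reflection form a y) = form x y.
Proof.
rewrite /reflection formDl !sformNl !sformDr !sformNr !formZl !sformZr.
rewrite (formC a y) /pairing.
have [->|a0] := eqVneq (form a a) 0; first by rewrite invr0; ring.
by field.
Qed.

Lemma reflectionK a x : reflection form a (reflection form a x) = x.
Proof.
have [a0|a0] := eqVneq (form a a) 0.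
  by rewrite /reflection /pairing a0 invr0 !mulr0 !scale0r !subr0.
rewrite {2}/reflection reflectionB reflectionZ reflection_selfN //.
by rewrite scalerN opprK /reflection subrK.
Qed.

Lemma reflection_conj a b x :
  reflection form (reflection form a b) x =
  reflection form a (reflection form b (reflection form a x)).
Proof.
rewrite /(reflection form b) reflectionB reflectionK reflectionZ.
congr (_ - _ *: _); rewrite /pairing reflection_isometry.
by rewrite -{1}(reflectionK a x) reflection_isometry.
Qed.

Lemma reflection_coroot a b :
  form a a != 0 -> form b b != 0 ->
  coroot form (reflection form a b) =
  coroot form b - pairing form a b *: coroot form a.
Proof.
move=> a0 b0; rewrite /coroot reflection_isometry /reflection scalerBr !scalerA.
by congr (_ - _ *: _); rewrite /pairing (formC a b); field; rewrite a0.
Qed.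

Lemma corootZ k a : k != 0 -> coroot form (k *: a) = k^-1 *: coroot form a.
Proof.
move=> k0; rewrite /coroot formZl sformZr !scalerA; congr (_ *: _).
have [->|a0] := eqVneq (form a a) 0; first by rewrite !mulr0 invr0; ring.
by field; rewrite a0.
Qed.

Lemma coroot_involutive a : form a a != 0 -> coroot form (coroot form a) = a.
Proof.
move=> a0; rewrite /coroot formZl sformZr scalerA.
by rewrite (_ : _ * _ = 1) ?scale1r //; field; rewrite a0.
Qed.

End SymmetricForms.

(** * Arithmetic of lengths and Cartan integers *)

Section Rank2.
Variable R : realType.

(** Here A and B are the squared lengths of two vectors with inner product x, and
    m and n are their Cartan integers: m * n is four times the squared cosine of
    the angle, so this is the strict Cauchy-Schwarz inequality. *)
Lemma cartan_product_lt4 (A B x : R) (m n : int) :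
  0 < A -> 0 < B -> x ^+ 2 < A * B ->
  m%:~R * A = 2 * x -> n%:~R * B = 2 * x -> m * n < 4.
Proof.
move=> A0 B0 xAB mA nB; rewrite -(ltr_int R) intrM.
rewrite -(ltr_pM2r (mulr_gt0 A0 B0)) mulrACA mA nB; lra.
Qed.

Definition length_ratio (A B : R) :=
  A = B \/ A = 2 * B \/ A = 3 * B \/ B = 2 * A \/ B = 3 * A.

(** The numerical content of the rank two classification.  The numbers p and q are
    the Cartan integers of two vectors; r and t are those of each vector against
    their sum, while the sum has Cartan integers 2 + q and 2 + p against the two
    vectors.  The bound by 4 for these two pairs forces p, q <= 1 when the angle
    is acute. *)
Lemma rank2_sum_numbers (A B x : R) (p q r t : int) :
  0 < A -> 0 < B -> x ^+ 2 < A * B ->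
  q%:~R * A = 2 * x -> p%:~R * B = 2 * x ->
  r%:~R * (A + B + 2 * x) = 2 * (A + x) ->
  t%:~R * (A + B + 2 * x) = 2 * (B + x) ->
  [\/ p = - 1, q = - 1 | A = B /\ (x = 0 \/ 2 * x = A)].
Proof.
move=> A0 B0 xAB qA pB rC tC.
have C0 : 0 < A + B + 2 * x.
  rewrite ltNge; apply/negP => C0.
  (* Otherwise 4 * x ^+ 2 >= (A + B) ^+ 2 >= 4 * A * B. *)
  have : 0 <= (- (A + B + 2 * x)) * (A + B - 2 * x) by apply: mulr_ge0; lra.
  have := sqr_ge0 (A - B); nra.
have pq4 : p * q < 4.
  by apply: (@cartan_product_lt4 B A x) => //; rewrite mulrC.
have rq4 : (2 + q) * r < 4.
  apply: (@cartan_product_lt4 A (A + B + 2 * x) (A + x)) => //; first by nra.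
  by rewrite intrD; lra.
have tp4 : (2 + p) * t < 4.
  apply: (@cartan_product_lt4 B (A + B + 2 * x) (B + x)) => //; first by nra.
  by rewrite intrD; lra.
have int_pos (n : int) (D y : R) : 0 < D -> n%:~R * D = y -> (0 < n) = (0 < y).
  by move=> D0 <-; rewrite pmulr_lgt0 // ltr0z.
have pE := int_pos _ _ _ B0 pB; have qE := int_pos _ _ _ A0 qA.
have rE := int_pos _ _ _ C0 rC; have tE := int_pos _ _ _ C0 tC.
have [x0|x0|x0] := ltgtP x 0.
- have pN : p < 0 by rewrite -(ltrz0 R) -(pmulr_llt0 _ B0) pB; lra.
  have qN : q < 0 by rewrite -(ltrz0 R) -(pmulr_llt0 _ A0) qA; lra.
  have : p = -1 \/ q = -1 by nia.
  by case=> ->; [apply: Or31 | apply: Or32].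
- have p0 : 0 < p by rewrite pE; lra.
  have q0 : 0 < q by rewrite qE; lra.
  have r0 : 0 < r by rewrite rE; lra.
  have t0 : 0 < t by rewrite tE; lra.
  have p1 : p = 1 by nia.
  have q1 : q = 1 by nia.
  by apply: Or33; move: pB qA; rewrite p1 q1 => ? ?; split; [|right]; lra.
- apply: Or33; split; last by left.
  have r0 : 0 < r by rewrite rE; lra.
  have r2 : r < 2.
    by rewrite -(ltr_int R) -(ltr_pM2r C0) rC x0; lra.
  have r1 : r = 1 by lia.
  by move: rC; rewrite r1 x0 => ?; lra.
Qed.

(** The last hypothesis and L >= 2 * D give D <= 3/2 n, the one before gives
    D >= 2/3 n, and among the ratios of D to n only 1 is in that range. *)
Lemma length_from_ratios (n x D L : R) :
  0 < n -> 0 < D -> x = 0 \/ 2 * x = n -> L = 2 * D \/ L = 3 * D ->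
  length_ratio n D -> length_ratio (2 * n + 2 * x) D -> length_ratio n L ->
  D = n.
Proof.
move=> n0 D0 o L23 nD cD nL.
have L3 : L <= 3 * n by move: nL => [|[|[|[]]]]; move: L23 => []; lra.
have Dn : 2 * n <= 3 * D by move: o => []; move: cD => [|[|[|[]]]]; lra.
have D3 : 2 * D <= 3 * n by move: L23 => []; lra.
by move: nD => [|[|[|[]]]]; lra.
Qed.

End Rank2.

(** * Root systems: sums of two roots or of two coroots *)

Section DotForm.
Variables (R : realType) (V : vectType R) (dot : {dot V for idfun}).

Lemma dotC x y : dot x y = dot y x.
Proof. by rewrite hermC /= expr0 mul1r. Qed.

Lemma dotDl x y z : dot (x + y) z = dot x z + dot y z.
Proof. exact: linearDl. Qed.

Lemma dotZl k x y : dot (k *: x) y = k * dot x y.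
Proof. exact: linearZl_LR. Qed.

Lemma dotDr x y z : dot x (y + z) = dot x y + dot x z.
Proof. exact: (sformDr dotC dotDl). Qed.

Lemma dotZr k x y : dot x (k *: y) = k * dot x y.
Proof. exact: (sformZr dotC dotZl). Qed.

Lemma dot_gt0 x : x <> 0 -> 0 < dot x x.
Proof. by move=> /eqP x0; exact: neq0_dnorm_gt0. Qed.

Lemma Cauchy_Schwarz_eq x y : x <> 0 ->
  (exists k, y = k *: x) \/ dot x y ^+ 2 < dot x x * dot y y.
Proof.
move=> x0; have xx := dot_gt0 x0.
pose k := dot x y / dot x x.
have [yk|yk] := eqVneq (y - k *: x) 0.
  by left; exists k; apply/eqP; rewrite -subr_eq0 yk.
right; have := dot_gt0 (elimN eqP yk).
rewrite -scaleNr dotDl !dotDr !dotZl !dotZr (dotC y x) -(pmulr_lgt0 _ xx) /k.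
set d := _ * _ => d0; suff -> : dot x x * dot y y = dot x y ^+ 2 + d by rewrite ltrDl.
by rewrite /d; field; rewrite gt_eqF.
Qed.

Lemma pairingM a x : a <> 0 -> pairing dot x a * dot a a = 2 * dot x a.
Proof. by move=> /dot_gt0 a0; rewrite mulfVK ?gt_eqF. Qed.

Lemma coroot_neq0 a : a <> 0 -> coroot dot a <> 0.
Proof.
move=> a0 /eqP; rewrite scaler_eq0 mulf_eq0 invr_eq0 pnatr_eq0 /=.
by rewrite gt_eqF ?dot_gt0 //= => /eqP.
Qed.

Lemma pairing_coroot a b : a <> 0 -> b <> 0 ->
  pairing dot (coroot dot a) (coroot dot b) = pairing dot b a.
Proof.
move=> /dot_gt0/gt_eqF/negbT a0 /dot_gt0/gt_eqF/negbT b0.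
rewrite /pairing /coroot !(dotZl, dotZr) (dotC b a); field.
by rewrite a0 b0.
Qed.

(** Stated for vectors rather than for roots so as to apply to coroots too, whose
    Cartan integers are those of the roots transposed. *)
Lemma rank2_sum a b : a <> 0 -> b <> 0 -> a + b <> 0 ->
  dot a b ^+ 2 < dot a a * dot b b ->
  (exists n : int, pairing dot a b = n%:~R) ->
  (exists n : int, pairing dot b a = n%:~R) ->
  (exists n : int, pairing dot a (a + b) = n%:~R) ->
  (exists n : int, pairing dot b (a + b) = n%:~R) ->
  [\/ pairing dot a b = - 1, pairing dot b a = - 1
    | dot a a = dot b b /\ (dot a b = 0 \/ 2 * dot a b = dot a a)].
Proof.
move=> a0 b0 c0 ab [p pE] [q qE] [r rE] [t tE].
have cc : dot (a + b) (a + b) = dot a a + dot b b + 2 * dot a b.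
  by rewrite !dotDl !dotDr (dotC b a); ring.
have := @rank2_sum_numbers R _ _ _ p q r t (dot_gt0 a0) (dot_gt0 b0) ab.
rewrite -pE -qE -rE -tE -cc !pairingM // !dotDr !(dotC b a) (addrC _ (dot b b)).
case=> // h; rewrite ?pE ?qE ?h; by [apply: Or31|apply: Or32|apply: Or33].
Qed.

End DotForm.

Section RootSystem.
Variables (R : realType) (V : vectType R) (dot : {dot V for idfun}) (Phi0 : set V).
Hypothesis Phi0_root : is_root_system dot Phi0.

Lemma roots_proportional a b : Phi0 a -> Phi0 b ->
  [\/ b = a, b = - a | dot a b ^+ 2 < dot a a * dot b b].
Proof.
move=> ha hb.
have [[k bk]|] := Cauchy_Schwarz_eq dot b (root_neq0 Phi0_root ha); last exact: Or33.
have : k = 1 \/ k = -1 by apply: (root_reduced Phi0_root ha); rewrite -bk.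
by case=> kE; move: bk; rewrite kE (scale1r, scaleN1r); [exact: Or31|exact: Or32].
Qed.

Lemma double_not_root a : Phi0 a -> ~ Phi0 (a + a).
Proof.
move=> ha; rewrite -mulr2n -scaler_nat => /(root_reduced Phi0_root ha).
by case=> h; lra.
Qed.

(** In the first two cases a + b is a reflection of b or a; in the last one the
    two roots span B2 or G2 and a + b is longer than both. *)
Lemma root_sum a b : Phi0 a -> Phi0 b -> Phi0 (a + b) ->
  [\/ pairing dot a b = - 1, pairing dot b a = - 1
    | dot a a = dot b b /\ (dot a b = 0 \/ 2 * dot a b = dot a a)].
Proof.
move=> ha hb hc; have n0 := root_neq0 Phi0_root.
have cr := root_crystallographic Phi0_root.
apply: rank2_sum; do ?[exact: n0 | exact: cr].
have [ba|ba|//] := roots_proportional ha hb.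
  by case: (double_not_root ha); rewrite -{2}ba.
by case: (n0 _ hc); rewrite ba subrr.
Qed.

(** The dual statement: in the last case the coroots have equal length and are
    orthogonal or at 60 degrees, so that c is a multiple of a + b from which its
    length can be read off. *)
Lemma coroot_sum a b c : Phi0 a -> Phi0 b -> Phi0 c ->
  coroot dot a + coroot dot b = coroot dot c ->
  [\/ pairing dot a b = - 1, pairing dot b a = - 1
    | [/\ dot a a = dot b b, dot a c <> 0 &
          dot a a = 2 * dot c c \/ dot a a = 3 * dot c c]].
Proof.
move=> ha hb hc abc; have n0 := root_neq0 Phi0_root.
have cr := root_crystallographic Phi0_root.
have [[a0 b0] c0] := (n0 _ ha, n0 _ hb, n0 _ hc).
have [[A0 B0] C0] := (dot_gt0 dot a0, dot_gt0 dot b0, dot_gt0 dot c0).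
have c'0 := coroot_neq0 (dot := dot) c0.
have [A1 B1 C1] : [/\ dot a a != 0, dot b b != 0 & dot c c != 0].
  by rewrite !gt_eqF.
have := @rank2_sum _ _ dot (coroot dot a) (coroot dot b).
rewrite abc !pairing_coroot // => /(_ (coroot_neq0 (dot := dot) a0) (coroot_neq0 (dot := dot) b0) c'0).
have ab : dot (coroot dot a) (coroot dot b) ^+ 2 <
  dot (coroot dot a) (coroot dot a) * dot (coroot dot b) (coroot dot b).
  have [ba|ba|h] := roots_proportional ha hb.
  (* If b = a, then c = a / 2, against reducedness. *)
  - have := congr1 (coroot dot) abc; rewrite ba -mulr2n -scaler_nat.
    rewrite (corootZ (dotC dot) (dotZl dot)) ?pnatr_eq0 //.
    rewrite !(coroot_involutive (dotC dot) (dotZl dot)) // => cE.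
    have : Phi0 (2^-1 *: a) by rewrite cE.
    by case/(root_reduced Phi0_root ha) => h; lra.
  - case: c'0; rewrite -abc ba -[- a]scaleN1r (corootZ (dotC dot) (dotZl dot)).
      by rewrite invrN1 scaleN1r subrr.
    by rewrite oppr_eq0 oner_eq0.
  - rewrite /coroot !dotZl !dotZr.
    have k0 : 0 < (2 / dot a a * (2 / dot b b)) ^+ 2 by rewrite exprn_gt0 // !mulr_gt0 ?invr_gt0.
    rewrite -(ltr_pM2l k0) in h; apply: le_lt_trans (lt_le_trans h _); rewrite le_eqVlt.
      by apply/orP; left; apply/eqP; ring.
    by apply/orP; left; apply/eqP; field; rewrite A1 B1.
move=> /(_ ab (cr _ _ ha hb) (cr _ _ hb ha) (cr _ _ ha hc) (cr _ _ hb hc)).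
case=> [h|h|]; [exact: Or32|exact: Or31|rewrite /coroot !dotZl !dotZr].
move=> [AB xE].
have {}AB : dot a a = dot b b.
  apply: invr_inj; apply: (@mulfI _ 4); first by rewrite pnatr_eq0.
  transitivity (2 / dot a a * (2 / dot a a * dot a a)); first by field.
  by rewrite AB; field.
have {}xE : dot a b = 0 \/ 2 * dot a b = dot a a.
  rewrite -AB in xE; case: xE => xE; [left|right].
    have -> : dot a b = (dot a a / 2) * (dot a a / 2) *
        (2 / dot a a * (2 / dot a a * dot a b)) by field.
    by rewrite xE mulr0.
  have -> : 2 * dot a b = (dot a a / 2) * (dot a a / 2) *
      (2 * (2 / dot a a * (2 / dot a a * dot a b))) by field.
  by rewrite xE; field.
have cE : c = (dot c c / dot a a) *: (a + b).
  have := congr1 (fun v => (dot c c / 2) *: v) abc.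
  rewrite /coroot -AB -scalerDr !scalerA => h.
  have -> : dot c c / dot a a = dot c c / 2 * (2 / dot a a) by field.
  rewrite h -{1}[c]scale1r; congr (_ *: _); by field.
have acE : dot a c * dot a a = dot c c * (dot a a + dot a b).
  by rewrite {1}cE dotZr dotDr; field.
have ccE : dot a a * dot a a = dot c c * (2 * dot a a + 2 * dot a b).
  have := congr1 (fun v => dot v v) cE.
  rewrite /= !(dotZl, dotZr) dotDl !dotDr -AB (dotC dot b a) => h.
  apply: (mulfI C1); rewrite {1}h; field; exact: A1.
apply: Or33; split=> //.
  have pos : 0 < dot a a + dot a b by move: A0 xE; clear; move=> ? [] ?; lra.
  move=> ac0; have := mulr_gt0 C0 pos.
  by rewrite -acE ac0 mul0r ltxx.
case: xE => xE; [left|right].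
  by apply: (mulfI A1); rewrite ccE xE; ring.
by apply: (mulfI A1); rewrite ccE xE; ring.
Qed.

(** The ratio of the squared lengths is the ratio of two nonzero Cartan integers
    of the same sign whose product is at most 3. *)
Lemma nonorthogonal_ratio a b : Phi0 a -> Phi0 b -> dot a b <> 0 ->
  length_ratio (dot a a) (dot b b).
Proof.
move=> ha hb /eqP x0; have n0 := root_neq0 Phi0_root.
have [a0 b0] := (n0 _ ha, n0 _ hb).
have [A0 B0] := (dot_gt0 dot a0, dot_gt0 dot b0).
have [->|->|ab] := roots_proportional ha hb; first by left.
  by left; rewrite -scaleN1r dotZl dotZr; ring.
have [p pE] := root_crystallographic Phi0_root hb ha.
have [q qE] := root_crystallographic Phi0_root ha hb.
have := pairingM dot a b0; have := pairingM dot b a0.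
rewrite pE qE (dotC dot b a) => qA pB.
have qp4 := cartan_product_lt4 A0 B0 ab qA pB.
have p0 : p != 0.
  by apply: contraNneq x0 => p0; move: pB; rewrite p0 mul0r => /esym/eqP; rewrite mulf_eq0 pnatr_eq0.
have qp0 : 0 < q * p.
  rewrite -(ltr0z R) intrM -(pmulr_lgt0 _ A0) -(pmulr_lgt0 _ B0) -mulrA.
  have -> : q%:~R * p%:~R * (dot a a * dot b b) = (q%:~R * dot a a) * (p%:~R * dot b b) by ring.
  rewrite qA pB -expr2 exprn_even_gt0 //= mulf_neq0 ?pnatr_eq0 //.
have : p = q \/ p = 2 * q \/ p = 3 * q \/ q = 2 * p \/ q = 3 * p.
  have : (p = 1 \/ p = - 1) \/ (q = 1 \/ q = - 1) by nia.
  by move=> [[]|[]] e; subst; lia.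
have : q%:~R * dot a a = p%:~R * dot b b by rewrite qA pB.
have q0 : q != 0 by nia.
move: (dot a a) (dot b b) => A B e; move: e.
have [p1 q1] : p%:~R != 0 :> R /\ q%:~R != 0 :> R by rewrite !intr_eq0.
move=> e [pq|[pq|[pq|[pq|pq]]]]; move: e; rewrite pq ?intrM => e.
- by left; apply: (mulfI q1).
- by right; left; apply: (mulfI q1); rewrite e; ring.
- by do 2 right; left; apply: (mulfI q1); rewrite e; ring.
- by do 3 right; left; apply: (mulfI p1); rewrite -e; ring.
- by do 4 right; apply: (mulfI p1); rewrite -e; ring.
Qed.

Lemma pairing_same_norm a b : Phi0 a -> Phi0 b -> dot a a = dot b b ->
  exists n : int, [/\ pairing dot a b = n%:~R, - 2 <= n <= 2 & n = 2 -> a = b].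
Proof.
move=> ha hb AB; have b0 := root_neq0 Phi0_root hb.
have B0 := dot_gt0 dot b0; have B1 : dot b b != 0 by rewrite gt_eqF.
have [->|->|ab] := roots_proportional hb ha.
- by exists 2; rewrite pairing_self.
- exists (- 2); split=> //.
  by rewrite (pairingNl (dotZl dot)) pairing_self // mulrNz.
have [n nE] := root_crystallographic Phi0_root hb ha.
have nB := pairingM dot a b0; rewrite nE (dotC dot a b) in nB.
rewrite AB in ab; have n4 := cartan_product_lt4 B0 B0 ab nB nB.
by exists n; split=> // [|n2]; [nia|rewrite n2 in n4].
Qed.

End RootSystem.

(** * Real roots and their reflections *)

Section AffineReflectionSystem.
Variables (R : realType) (V Y : vectType R) (dot : {dot V for idfun}).
Variables (Phi0 : set V) (Lam : V -> set Y).
Hypotheses (Phi0_root : is_root_system dot Phi0)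
           (Lam_ext : is_extension_datum dot Phi0 Lam).

Local Notation form := (@ext_form R V Y dot).
Local Notation Phi := (real_roots Phi0 Lam).
Local Notation refl := (reflection form).

Lemma ext_formC x y : form x y = form y x.
Proof. exact: dotC. Qed.

Lemma ext_formDl x y z : form (x + y) z = form x z + form y z.
Proof. exact: dotDl. Qed.

Lemma ext_formZl k x y : form (k *: x) y = k * form x y.
Proof. exact: dotZl. Qed.

Lemma ext_formDr x y z : form x (y + z) = form x y + form x z.
Proof. exact: dotDr. Qed.

Lemma real_root_fst z : Phi z -> Phi0 z.1.
Proof. by case=> a ha [y _ <-]. Qed.

Lemma real_rootP a y : Phi (a, y) <-> Phi0 a /\ Lam a y.
Proof.
split; last by move=> [ha hy]; exists a => //; exists y.
by case=> b hb [x hx [<- <-]].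
Qed.

Lemma real_root_gt0 z : Phi z -> 0 < form z z.
Proof. by move=> /real_root_fst hz; apply: dot_gt0; exact: root_neq0 Phi0_root _ hz. Qed.

Lemma real_root_neq0 z : Phi z -> form z z != 0.
Proof. by move=> /real_root_gt0 z0; rewrite gt_eqF. Qed.

Lemma real_root_refl a b : Phi a -> Phi b -> Phi (refl a b).
Proof.
case: a b => [a x] [b y] /real_rootP[ha hx] /real_rootP[hb hy].
apply/real_rootP; split; first exact: root_refl Phi0_root _ _ ha hb.
exact: ext_refl Lam_ext _ _ ha hb _ _ hy hx.
Qed.

Lemma real_rootN a : Phi a -> Phi (- a).
Proof.
move=> ha; rewrite -(reflection_selfN (form := form) (real_root_neq0 ha)).
exact: real_root_refl.
Qed.

Lemma zero_section_root a : Phi0 a -> Phi (a, 0).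
Proof. by move=> ha; apply/real_rootP; split=> //; apply: ext_zero Lam_ext _ _; left. Qed.

Lemma reflection_isom a x y : form (refl a x) (refl a y) = form x y.
Proof. exact: reflection_isometry ext_formC ext_formDl ext_formZl _ _ _. Qed.

(** A product of two reflections in roots over the same finite root acts on V * Y
    by (v, y) |-> (v, y + f v) with f linear; a third such reflection, composed
    with it, only has the Y part of its root shifted. *)
Lemma three_reflections a b c x : b.1 = a.1 -> c.1 = a.1 -> form a a != 0 ->
  refl (a - b + c) x = refl a (refl b (refl c x)).
Proof.
move=> ba ca a0.
have pE (z : V * Y) v : z.1 = a.1 -> pairing form v z = pairing form v a.
  by rewrite /pairing /ext_form => ->.
have rE (z : V * Y) v : z.1 = a.1 -> refl z v = v - pairing form v a *: z.
  by move=> za; rewrite /reflection pE.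
(* Each reflection changes the sign of the common pairing with a. *)
have flip (z : V * Y) v : z.1 = a.1 -> pairing form (refl z v) a = - pairing form v a.
  move=> za; rewrite rE // (pairingDl ext_formDl) (pairingNl ext_formZl) (pairingZl ext_formZl).
  have -> : pairing form z a = 2 by rewrite /pairing /ext_form za mulfK.
  by ring.
rewrite [in RHS](rE a) // !flip // opprK (rE b) // flip // (rE c) // rE; last first.
  by rewrite /= ba ca subrK.
by rewrite scalerDr scalerBr !opprD !opprK scaleNr opprK -!addrA; congr (_ + _); rewrite addrC -addrA addrCA.
Qed.

(** * Maximal subsystems *)

Section Maximal.
Variable Psi : set (V * Y).
Hypothesis Psi_max : is_maximal_root_subsystem form Phi Psi.

Lemma Psi_sub z : Psi z -> Phi z.
Proof. by case: Psi_max => -[_ h _] _ _; apply: h. Qed.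

Lemma Psi_refl a b : Psi a -> Psi b -> Psi (refl a b).
Proof. by case: Psi_max => -[_ _ h] _ _; apply: h. Qed.

Lemma maximal_dichotomy (Theta : set (V * Y)) :
  Theta `<=` Phi -> Psi `<=` Theta ->
  (forall a b, Theta a -> Theta b -> Theta (refl a b)) ->
  Phi `<=` Theta \/ Theta `<=` Psi.
Proof.
case: Psi_max => -[Psi0 _ _] _ noext TPhi PsiT Trefl.
have [|PhiT] := pselect (Phi `<=` Theta); first by left.
right; apply: contrapT => TPsi; apply: noext; exists Theta; split=> //.
by split=> //; apply: subset_nonempty Psi0.
Qed.

(** The set S of the introduction.  The roots l of squared length n are left out
    because all the real roots of that length will be added to Psi anyway. *)
Definition length_stabilizer n : set (V * Y) :=
  [set z | [/\ Phi z, form z z = n &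
    forall l, Psi l -> form l l <> n -> Psi (refl z l)]].

Lemma Psi_stabilizer z : Psi z -> length_stabilizer (form z z) z.
Proof. by move=> hz; split=> // [|l hl _]; [exact: Psi_sub|exact: Psi_refl]. Qed.

Lemma stabilizer_refl n a z : Psi a -> length_stabilizer n z ->
  length_stabilizer n (refl a z).
Proof.
move=> ha [hz zn zl]; split.
- exact: real_root_refl (Psi_sub ha) hz.
- by rewrite reflection_isom.
move=> l hl ln; rewrite (reflection_conj ext_formC ext_formDl ext_formZl).
apply: Psi_refl => //; apply: zl; first exact: Psi_refl.
by rewrite reflection_isom.
Qed.

Lemma stabilizerN n z : length_stabilizer n z -> length_stabilizer n (- z).
Proof.
move=> [hz zn zl]; split; first exact: real_rootN.
  by rewrite -scaleN1r ext_formZl ext_formC ext_formZl zn; ring.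
by move=> l hl ln; rewrite (reflectionN ext_formC ext_formZl); apply: zl.
Qed.

(** The preimage in Phi of the projection of Psi to the finite root system is a
    subsystem containing Psi, so it is Phi or Psi. *)
Lemma root_over_or_preimage c : Phi0 c ->
  (exists2 r, Psi r & r.1 = c) \/
  (forall z t, Phi z -> Psi t -> t.1 = z.1 -> Psi z).
Proof.
move=> hc; pose Theta := [set z | Phi z /\ exists2 t, Psi t & t.1 = z.1].
have [||a b [ha [t ht ta]] [hb [u hu ub]]|PhiT|TPsi] := @maximal_dichotomy Theta.
- by move=> z [].
- by move=> z hz; split; [exact: Psi_sub|exists z].
- split; first exact: real_root_refl.
  exists (refl t u); first exact: Psi_refl.
  by rewrite /reflection /pairing /ext_form /= ta ub.
- by left; have [_ [t ht tc]] := PhiT _ (zero_section_root hc); exists t.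
- by right=> z t hz ht tz; apply: TPsi; split=> //; exists t.
Qed.

Lemma reflection_pairing1 a x : pairing form x a = 1 -> refl a x = x - a.
Proof. by rewrite /reflection => ->; rewrite scale1r. Qed.

(** The exceptional case of the stability of S under the reflection in a + b.
    The new root d - (a + b) lies over - b, and differs from - b by a vector of
    Y, just as d differs from a.  A root of Psi over a - b allows one to carry
    this difference from the direction a to the direction b. *)
Lemma stabilizer_orthogonal a b d :
  Psi a -> Psi b -> Phi (a + b) -> form a a = form b b -> form a b = 0 ->
  length_stabilizer (form a a) d -> d.1 = a.1 ->
  length_stabilizer (form a a) (d - (a + b)).
Proof.
move=> ha hb hc ab o hd da.
have [hdP dn dl] := hd.
have a0 := real_root_neq0 (Psi_sub ha).
have b0 := real_root_neq0 (Psi_sub hb).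
(* Since a and b are orthogonal, a - b is the reflection of a + b in b. *)
have hbc : Phi0 (a.1 - b.1).
  have -> : a.1 - b.1 = reflection dot b.1 (a + b).1.
    rewrite /reflection (pairingDl (dotDl dot)) pairing_self // /pairing.
    rewrite -/(form a b) o mulr0 mul0r add0r /= scaler_nat mulr2n opprD.
    by rewrite addrA addrK.
  by apply: (root_refl Phi0_root); [exact: real_root_fst (Psi_sub hb)|exact: real_root_fst hc].
have hdc : Phi (d - (a + b)).
  have -> : d - (a + b) = refl (a + b) d.
    rewrite reflection_pairing1 // /pairing /ext_form da -!/(form _ _).
    rewrite -/(form a (a + b)) -/(form (a + b) (a + b)).
    rewrite ext_formDl !ext_formDr (ext_formC b a) o -ab addr0 add0r.
    by rewrite -mulr2n mulr_natl divff // mulrn_eq0.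
  exact: real_root_refl.
have [[r hr rc]|pre] := root_over_or_preimage hbc; last first.
  (* Psi is a full preimage: it contains - b, hence every root over - b. *)
  rewrite ab -[form b b](_ : form (d - (a + b)) (d - (a + b)) = _); last first.
    rewrite /ext_form /= da opprD addrA subrr add0r.
    by rewrite (sformNl (dotZl dot)) (sformNr (dotC dot) (dotZl dot)) opprK.
  apply: Psi_stabilizer; apply: (pre _ (- b)) => //=.
    by rewrite -(reflection_selfN b0); exact: Psi_refl.
  by rewrite da opprD addrA subrr add0r.
(* The reflection in r exchanges the roots over a with those over b. *)
have r1 x : x.1 = a.1 -> refl r x = x - r.
  move=> xa; apply: reflection_pairing1.
  rewrite /pairing /ext_form rc xa -scaleN1r !(dotDl, dotDr, dotZl, dotZr).
  rewrite (dotC dot b.1) -!/(form _ _) o -ab !mulr0 add0r addr0 !mulN1r.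
  by rewrite opprK -mulr2n mulr_natl divff // mulrn_eq0.
have sE : refl r d = d - r by exact: r1.
have tE : refl r a = a - r by exact: r1.
have fstE x : x.1 = a.1 -> (x - r).1 = b.1.
  by move=> xa; rewrite /= xa rc opprB addrC subrK.
have hs := stabilizer_refl hr hd.
have ht : Psi (refl r a) by exact: Psi_refl.
have dE : - (d - (a + b)) = b - refl r d + refl r a.
  by rewrite sE tE !opprB -[RHS]addrA [r - d + _]addrC subrKA addrA (addrC b).
rewrite -[d - _]opprK; apply: stabilizerN; rewrite dE.
split.
- by rewrite -dE; exact: real_rootN.
- by rewrite -dE ab /ext_form /= da opprB addrC addKr.
move=> l hl ln.
rewrite three_reflections //; last first.
- by rewrite tE fstE.
- by rewrite sE fstE.
apply: Psi_refl => //; case: hs => _ _; apply; first exact: Psi_refl.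
by rewrite reflection_isom.
Qed.

Lemma pairing_formM x a : Phi a -> pairing form x a * form a a = 2 * form x a.
Proof. by move=> /real_root_neq0 a0; rewrite mulfVK. Qed.

(** If d has Cartan integer 1 with a and with a + b, then d - a has Cartan
    integer 1 with b: indeed the inner product of d - a with b is half of
    (a + b, a + b) - (a, a) - 2 (a, b) = (b, b).  So d - (a + b) arises from d by
    reflecting in a and then in b. *)
Lemma stabilizer_difference a b d :
  Psi a -> Psi b -> Phi (a + b) -> form a a = form b b ->
  length_stabilizer (form a a) d -> pairing form d (a + b) = 1 ->
  pairing form d a = 1 \/ (form a b = 0 /\ d.1 = a.1) ->
  length_stabilizer (form a a) (d - (a + b)).
Proof.
move=> ha hb hc ab hd d1; case=> [da|[o da]]; last exact: stabilizer_orthogonal.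
have b0 := real_root_neq0 (Psi_sub hb).
have -> : d - (a + b) = refl b (refl a d).
  rewrite (reflection_pairing1 da) reflection_pairing1 ?opprD ?addrA //.
  apply: (mulIf b0); rewrite pairing_formM ?mul1r; last exact: Psi_sub.
  have := pairing_formM d (Psi_sub ha); have := pairing_formM d hc.
  rewrite d1 da !mul1r -scaleN1r !(ext_formDl, ext_formDr, ext_formZl).
  rewrite (ext_formC b a) -ab => h1 h2; lra.
by do 2 apply: stabilizer_refl => //.
Qed.

(** With p, q, k the Cartan integers of d with a, b, a + b and m * n the squared
    length of a + b, one has p + q = k * m.  As p, q <= 2 with equality only for
    roots over a or b, the only solutions with k > 0 are k = 1 with p = 1, or
    q = 1, or m = 2 and {p, q} = {0, 2}, the exceptional case. *)
Lemma stabilizer_reflection_sum a b d :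
  Psi a -> Psi b -> Phi (a + b) -> form a a = form b b ->
  form a b = 0 \/ 2 * form a b = form a a ->
  length_stabilizer (form a a) d -> 0 < form d (a + b) ->
  length_stabilizer (form a a) (refl (a + b) d).
Proof.
move=> ha hb hc ab o hd dc0.
have [dP dn _] := hd.
have hfst := real_root_fst.
have a0 := real_root_neq0 (Psi_sub ha).
have [p [pE pb p2]] := pairing_same_norm Phi0_root (hfst _ dP) (hfst _ (Psi_sub ha)) dn.
have [q [qE qb q2]] : exists n : int,
    [/\ pairing dot d.1 b.1 = n%:~R, - 2 <= n <= 2 & n = 2 -> d.1 = b.1].
  apply: (pairing_same_norm Phi0_root (hfst _ dP) (hfst _ (Psi_sub hb))).
  by rewrite -/(form d d) dn ab.
have [k kE] := root_crystallographic Phi0_root (hfst _ hc) (hfst _ dP).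
have pA := pairing_formM d (Psi_sub ha); have qA := pairing_formM d (Psi_sub hb).
have kC := pairing_formM d hc.
rewrite [pairing _ _ _]pE in pA; rewrite [pairing _ _ _]qE -ab in qA.
have k0 : 0 < k.
  by rewrite -(ltr0z R) -(pmulr_lgt0 _ (real_root_gt0 hc)) -kE kC mulr_gt0.
have d1E : pairing form d (a + b) = k%:~R by [].
rewrite d1E in kC.
have pq2 : ~ (p = 2 /\ q = 2).
  move=> [/p2 da /q2 db]; have xA : form a b = form a a by rewrite /ext_form -db da.
  by case: o => h; have := real_root_gt0 (Psi_sub ha); lra.
have cc : form (a + b) (a + b) = 2 * form a a + 2 * form a b.
  by rewrite ext_formDl !ext_formDr (ext_formC b a) -ab; ring.
have [m [mE pqE]] : exists m : int, (m = 2 /\ form a b = 0 \/ m = 3) /\ p + q = k * m.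
  have inj (m : int) : form (a + b) (a + b) = m%:~R * form a a -> p + q = k * m.
    move=> cm; apply/eqP; rewrite -(eqr_int R) intrD intrM; apply/eqP.
    apply: (mulIf a0); rewrite mulrDl pA qA -mulrA -cm kC ext_formDr; ring.
  case: o => o; [exists 2|exists 3]; (split; [by tauto|apply: inj; rewrite cc]); lra.
have k1 : k = 1 by case: mE => [[mE _]|mE]; rewrite mE in pqE; lia.
rewrite k1 in d1E pqE; rewrite (reflection_pairing1 d1E).
have : (p = 1 \/ (form a b = 0 /\ d.1 = a.1)) \/ (q = 1 \/ (form a b = 0 /\ d.1 = b.1)).
  case: mE => [[mE x0]|mE]; rewrite mE in pqE.
    have : p = 1 \/ p = 2 \/ q = 2 by lia.
    by case=> [?|[/p2 ?|/q2 ?]]; tauto.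
  have : p = 1 \/ q = 1 by lia.
  by tauto.
case=> h.
  by apply: stabilizer_difference => //; case: h => [h|]; [left; rewrite /pairing -/(pairing _ _ _) [LHS]pE h|right].
rewrite ab in hd *; rewrite [a + b]addrC in hc d1E *.
apply: stabilizer_difference => //.
by case: h => [h|[h ?]]; [left; rewrite [LHS]qE h|right; rewrite ext_formC].
Qed.

(** Three uses of maximality: the roots whose reflections preserve S form a
    subsystem containing Psi and a + b; so do, as a consequence, the members of
    S together with all the roots of other lengths; hence every root of squared
    length n is in S, and adding these roots to Psi gives a subsystem, which
    misses a + b because of its length. *)
Lemma roots_of_summand_length a b : Psi a -> Psi b -> Phi (a + b) -> ~ Psi (a + b) ->
  form a a = form b b -> form a b = 0 \/ 2 * form a b = form a a ->
  forall z, Phi z -> form z z = form a a -> Psi z.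
Proof.
move=> ha hb hc hn ab o; set n := form a a.
have cn : form (a + b) (a + b) <> n.
  have := real_root_gt0 (Psi_sub ha).
  rewrite ext_formDl !ext_formDr (ext_formC b a) -ab /n; case: o; lra.
have conj := reflection_conj ext_formC ext_formDl ext_formZl.
have stable z d : Phi z -> length_stabilizer n d -> length_stabilizer n (refl z d).
  move=> hz; pose Theta :=
    [set z | Phi z /\ forall d, length_stabilizer n d -> length_stabilizer n (refl z d)].
  suff : Phi `<=` Theta by move=> /(_ _ hz)[_]; apply.
  have [||x y [hx xs] [hy ys]|//|TPsi] := @maximal_dichotomy Theta.
  - by move=> ? [].
  - by move=> x hx; split; [exact: Psi_sub|move=> e; exact: stabilizer_refl].
  - split; first exact: real_root_refl.
    by move=> e he; rewrite conj; apply/xs/ys/xs.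
  - case: hn; apply: TPsi; split=> // e he.
    have [dc|dc|dc] := ltgtP (form e (a + b)) 0.
    + rewrite -[e]opprK (reflection_of_opp ext_formZl); apply: stabilizerN.
      apply: stabilizer_reflection_sum => //; first exact: stabilizerN.
      by rewrite -scaleN1r ext_formZl mulN1r oppr_gt0.
    + exact: stabilizer_reflection_sum.
    + by rewrite /reflection /pairing dc mulr0 mul0r scale0r subr0.
have all_stable z : Phi z -> form z z = n -> length_stabilizer n z.
  move=> hz; pose Theta := [set z | Phi z /\ (form z z = n -> length_stabilizer n z)].
  suff : Phi `<=` Theta by move=> /(_ _ hz)[].
  have [||x y [hx _] [hy ys]|//|TPsi] := @maximal_dichotomy Theta.
  - by move=> ? [].
  - by move=> x hx; split; [exact: Psi_sub|move=> <-; exact: Psi_stabilizer].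
  - split; first exact: real_root_refl.
    by rewrite reflection_isom => /ys; apply: stable.
  - by case: hn; apply: TPsi; split.
move=> z hz zn; pose Theta := [set z | Phi z /\ (Psi z \/ form z z = n)].
have [||x y [hx xs] [hy ys]|PhiT|TPsi] := @maximal_dichotomy Theta.
- by move=> ? [].
- by move=> x hx; split; [exact: Psi_sub|left].
- split; first exact: real_root_refl.
  have [yn|yn] := pselect (form y y = n); first by right; rewrite reflection_isom.
  left; case: ys => // {}ys; case: xs => [xs|xn]; first exact: Psi_refl.
  by have [_ _] := all_stable _ hx xn; apply.
- by have [_ []] := PhiT _ hc.
- by apply: TPsi; split=> //; right.
Qed.

(** Replaces the decomposition into irreducible components.  The real roots which
    are not orthogonal to all finite roots of squared length n are orthogonal to
    the remaining ones, so adding them to Psi gives a subsystem; if it contains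
    one root outside Psi, it contains all of them. *)
Lemma missing_nonorthogonal c d n : Phi c -> ~ Psi c -> Phi d -> ~ Psi d ->
  (exists a, [/\ Phi0 a, dot a a = n & dot a c.1 <> 0]) ->
  exists a, [/\ Phi0 a, dot a a = n & dot a d.1 <> 0].
Proof.
move=> hc nc hd nd wc.
pose K (z : V * Y) := exists a, [/\ Phi0 a, dot a a = n & dot a z.1 <> 0].
pose Theta := [set z | Phi z /\ (Psi z \/ K z)].
have isom a x y : dot (reflection dot a x) (reflection dot a y) = dot x y.
  exact: reflection_isometry (dotC dot) (dotDl dot) (dotZl dot) _ _ _.
have [||x y [hx xs] [hy ys]|PhiT|TPsi] := @maximal_dichotomy Theta.
- by move=> ? [].
- by move=> x hx; split; [exact: Psi_sub|left].
- split; first exact: real_root_refl.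
  have hx0 := real_root_fst hx.
  have [[a [ha an ay]]|yK] := pselect (K y).
    right; exists (reflection dot x.1 a); split; [|by rewrite isom|by rewrite isom].
    exact: root_refl Phi0_root _ _ hx0 ha.
  left; case: ys => // {}ys; case: xs => [xs|[a [ha an ax]]]; first exact: Psi_refl.
  have orth b : Phi0 b -> dot b b = n -> dot b y.1 = 0.
    by move=> hb bn; apply: contrapT => hby; apply: yK; exists b.
  (* As y is orthogonal to a and to its reflection in x, it is orthogonal to x. *)
  have := orth _ (root_refl Phi0_root hx0 ha); rewrite isom => /(_ an).
  rewrite /reflection -scaleNr dotDl dotZl (orth a) // add0r => /eqP.
  rewrite mulf_eq0 oppr_eq0 mulf_eq0 invr_eq0 (negPf (real_root_neq0 hx)) orbF.
  rewrite mulf_eq0 pnatr_eq0 /= (negPf (introN eqP ax)) /= => /eqP xy.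
  by rewrite /reflection /pairing ext_formC /ext_form xy mulr0 mul0r scale0r subr0.
- by have [_ []] := PhiT _ hd.
- by case: nc; apply: TPsi; split=> //; right.
Qed.

End Maximal.

(** * Closed or dually closed *)

Lemma maximal_closed_or_dual_closed (Psi : set (V * Y)) :
  is_maximal_root_subsystem form Phi Psi ->
  closed_in Phi Psi \/ closed_in (dual dot Phi) (dual dot Psi).
Proof.
move=> Psi_max.
have sub := Psi_sub Psi_max; have stable := Psi_refl Psi_max.
have [|] := pselect (closed_in Phi Psi); first by left.
move=> /existsNP[a /existsNP[b /not_implyP[ha /not_implyP[hb /not_implyP[hc nc]]]]].
right=> _ _ [l hl <-] [m hm <-] [d hd /esym lm]; apply: contrapT => nd.
have {}nd : ~ Psi d by move=> hd'; apply: nd; exists d.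
have hfst := real_root_fst.
have ref1 x y : pairing form y x = - 1 -> refl x y = x + y.
  by rewrite /reflection => ->; rewrite scaleN1r opprK addrC.
have [ab o] : form a a = form b b /\ (form a b = 0 \/ 2 * form a b = form a a).
  have [h|h|//] := root_sum Phi0_root (hfst _ (sub _ ha)) (hfst _ (sub _ hb)) (hfst _ hc).
    by case: nc; rewrite addrC -ref1 //; exact: stable.
  by case: nc; rewrite -ref1 //; exact: stable.
have corootE x y : Phi x -> Phi y -> pairing form x y = - 1 ->
    coroot form (refl x y) = coroot form x + coroot form y.
  move=> hx hy xy; rewrite (reflection_coroot ext_formC
    ext_formDl ext_formZl) ?(real_root_neq0 hx) ?(real_root_neq0 hy) //.
  by rewrite xy scaleN1r opprK addrC.
have corootI : forall x y, Phi x -> Phi y -> coroot form x = coroot form y -> x = y.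
  move=> x y hx hy xy.
  have inv := coroot_involutive ext_formC ext_formZl.
  by rewrite -(inv x) ?xy ?inv ?(real_root_neq0 hx) ?(real_root_neq0 hy).
have lm1 : coroot dot l.1 + coroot dot m.1 = coroot dot d.1 by have := congr1 (fun z => z.1) lm.
have [h|h|[lmE ld lm23]] :=
    coroot_sum Phi0_root (hfst _ (sub _ hl)) (hfst _ (sub _ hm)) (hfst _ hd) lm1.
- case: nd; rewrite -(corootI _ _ _ hd (etrans (corootE _ _ (sub _ hl) (sub _ hm) h) lm)).
    exact: stable.
  by apply: real_root_refl; exact: sub.
- move: lm; rewrite addrC => ml.
  case: nd; rewrite -(corootI _ _ _ hd (etrans (corootE _ _ (sub _ hm) (sub _ hl) h) ml)).
    exact: stable.
  by apply: real_root_refl; exact: sub.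
have A0 := real_root_gt0 (sub _ ha).
have [hd0 hl0 hc0] := And3 (hfst _ hd) (hfst _ (sub _ hl)) (hfst _ hc).
have cc : form (a + b) (a + b) = 2 * form a a + 2 * form a b.
  by rewrite ext_formDl !ext_formDr (ext_formC b a) -ab; ring.
have [e [he en ed]] : exists e, [/\ Phi0 e, dot e e = form a a & dot e d.1 <> 0].
  apply: (missing_nonorthogonal Psi_max hc nc hd nd); exists a.1.
  split; [exact: hfst _ (sub _ ha)|by []|].
  rewrite -/(form a (a + b)) ext_formDr; case: o; lra.
have [f [hf fn fd]] :
    exists f, [/\ Phi0 f, dot f f = form (a + b) (a + b) & dot f d.1 <> 0].
  apply: (missing_nonorthogonal Psi_max hc nc hd nd); exists (a + b).1.
  by split=> //; exact: (elimN eqP (real_root_neq0 hc)).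
(* One of e and its reflection in d is not orthogonal to l, since l is not
   orthogonal to d. *)
have [g [hg gn gl]] : exists g, [/\ Phi0 g, dot g g = form a a & dot g l.1 <> 0].
  have [el|el] := pselect (dot e l.1 = 0); last by exists e.
  exists (reflection dot d.1 e); split; first exact: root_refl Phi0_root _ _ hd0 he.
    by rewrite (reflection_isometry (dotC dot) (dotDl dot) (dotZl dot)).
  rewrite /reflection -scaleNr dotDl dotZl el add0r => /eqP.
  rewrite mulf_eq0 oppr_eq0 (dotC dot d.1) (negPf (introN eqP ld)) orbF.
  rewrite !mulf_eq0 pnatr_eq0 /= (negPf (introN eqP ed)) invr_eq0 /=.
  by rewrite (negPf (real_root_neq0 hd)).
have := nonorthogonal_ratio Phi0_root he hd0 ed.
have := nonorthogonal_ratio Phi0_root hf hd0 fd.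
have := nonorthogonal_ratio Phi0_root hg hl0 gl.
have D0 := real_root_gt0 hd.
rewrite en fn gn cc -/(form d d) => hl3 hd3 hdn.
case: nd; have h1 := roots_of_summand_length Psi_max ha hb hc nc ab o hd; apply: h1.
exact: (length_from_ratios A0 D0 o lm23 hdn hd3 hl3).
Qed.

End AffineReflectionSystem.

Theorem theorem5 (R : realType) (V Y : vectType R) (dot : {dot V for idfun})
    (Phi0 : set V) (Lam : V -> set Y) (Psi : set (V * Y)) :
  is_root_system dot Phi0 ->
  is_extension_datum dot Phi0 Lam ->
  B2_condition dot Phi0 Lam ->
  is_maximal_root_subsystem (ext_form dot) (real_roots Phi0 Lam) Psi ->
  closed_in (real_roots Phi0 Lam) Psi \/
  closed_in (dual dot (real_roots Phi0 Lam)) (dual dot Psi).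
Proof.
move=> Phi0_root Lam_ext _.
exact: maximal_closed_or_dual_closed.
Qed.
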